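(* There exist a $*$-probability space $(\mathcal A,\varphi)$ and an $\eta$-diagonal pair $(x,y)$ of random variables in $\mathcal A$ such that $(xx^*,yy^* )$ and $(x^*x,y^*y)$ are not bi-Boolean independent.
   Context: A $*$-probability space $(\mathcal A,\varphi)$ is a unital $*$-algebra $\mathcal A$ over $\mathbb C$ with a linear functional $\varphi$ such that $\varphi(1)=1$ and $\varphi(a^* )=\overline{\varphi(a)}$. For $\chi:\{1,\dots,n\}\to\{l,r\}$, the permutation $s_\chi$ is defined by $\chi^{-1}(\{l\})=\{s_\chi(1)<\cdots<s_\chi(k)\}$, $\chi^{-1}(\{r\})=\{s_\chi(k+1)>\cdots>s_\chi(n)\}$; it gives the order $s_\chi(1)\prec_\chi\cdots\prec_\chi s_\chi(n)$. $BI(\chi)$ is the set of partitions of $\{1,\dots,n\}$ all of whose blocks are intervals for $\prec_\chi$. The bi-Boolean cumulants are the multilinear functionals $B_\chi:\mathcal A^n\to\mathbb C$ determined recursively by $\varphi(a_1\cdots a_n)=\sum_{\pi\in BI(\chi)}\prod_{V\in\pi}B_{\chi|_V}((a_1,\dots,a_n)|_V)$, with entries of $V$ taken in increasing natural order and $\chi|_V$ relabelled order-preservingly. $\eta$-diagonal pair: $(x,y)$ is $\eta$-diagonal if, for all $\chi:\{1,\dots,n\}\to\{l,r\}$ and all $z_1,\dots,z_n$ with $z_i\in\{x,x^*\}$ when $\chi(i)=l$ and $z_i\in\{y,y^*\}$ when $\chi(i)=r$, one has $B_\chi(z_1,\dots,z_n)=0$ unless $n=2m$ is even and $(z_{s_\chi(1)},\dots,z_{s_\chi(2m)})=(x^{\omega(1)},\dots,x^{\omega(k)},y^{\omega(k+1)},\dots,y^{\omega(2m)})$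 for some $0\le k\le 2m$ and some $\omega:\{1,\dots,2m\}\to\{1,*\}$ with $\omega(i)\neq\omega(i+1)$ for all $i$ (with $x,x^*,y,y^*$ treated as formal letters). Bi-Boolean independence: a family $\{(\mathcal A_{k,l},\mathcal A_{k,r})\}_{k\in K}$ of pairs of (non-unital) subalgebras of $\mathcal A$ is bi-Boolean independent if for all $n$, $\chi:\{1,\dots,n\}\to\{l,r\}$, $\omega:\{1,\dots,n\}\to K$ and $a_j\in\mathcal A_{\omega(j),\chi(j)}$, one has $\varphi(a_1\cdots a_n)=\prod_{V\in\pi_{\omega,\chi}}\varphi\big(\prod_{j\in V}a_j\big)$ (products in increasing order of $j$), where $\pi_{\omega,\chi}$ is the largest $\pi\in BI(\chi)$ such that $\omega$ is constant on each block of $\pi$. Pairs of elements $(a_1,b_1)$, $(a_2,b_2)$ are bi-Boolean independent if the pairs of non-unital subalgebras generated by $a_k$ (left) and $b_k$ (right), $k=1,2$, are bi-Boolean independent. *)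

(* Defs.v *)
(* The field of complex numbers is R[i], for R : realType. *)
From HB Require Import structures.
(* The classical libraries come first: [partition], [cover], ... are those of
   finset. *)
From mathcomp Require Import boolp classical_sets reals.
From mathcomp Require Import all_boot all_order all_algebra.
From mathcomp Require Import complex.
From mathcomp Require Import zify.

Set Implicit Arguments.
Unset Strict Implicit.
Unset Printing Implicit Defensive.

Import GRing.Theory Num.Theory.
Local Open Scope ring_scope.

(* The indices 1, ..., n are represented by 'I_n = {0, ..., n-1}. *)

Definition side := bool.
Definition lft : side := true.
Definition rgt : side := false.

(* An exponent in {1, *}. *)
Definition exponent := bool.
Definition expo1 : exponent := false.
Definition expo_star : exponent := true.

Record starProbSpace (R : realType) := StarProbSpace {
  alg :> algType R[i];
  star : alg -> alg;
  phi : {scalar alg};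
  starK : involutive star;
  starD : forall a b, star (a + b) = star a + star b;
  starZ : forall (c : R[i]) a, star (c *: a) = Num.conj c *: star a;
  starM : forall a b, star (a * b) = star b * star a;
  phi1 : phi 1 = 1;
  phi_star : forall a, phi (star a) = Num.conj (phi a)
}.
Arguments star {R s} _.
Arguments phi {R} s.

(* The list s_chi(1), ..., s_chi(n). *)
Definition s_chi n (chi : 'I_n -> side) : seq 'I_n :=
  [seq i <- enum 'I_n | chi i == lft]
    ++ rev [seq i <- enum 'I_n | chi i == rgt].

Definition chi_lt n (chi : 'I_n -> side) : rel 'I_n :=
  fun i j => (index i (s_chi chi) < index j (s_chi chi))%N.

Definition is_interval n (chi : 'I_n -> side) (V : {set 'I_n}) : bool :=
  [forall i in V, forall k in V, forall j,
     (chi_lt chi i j && chi_lt chi j k) ==> (j \in V)].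

Definition BI n (chi : 'I_n -> side) : {set {set {set 'I_n}}} :=
  [set pi : {set {set 'I_n}} |
     partition pi [set: 'I_n] && [forall V in pi, is_interval chi V]].

(* f|_V, relabelled by {0, ..., #|V|-1}: enum_val is increasing on 'I_#|V|. *)
Definition restr n (V : {set 'I_n}) (T : Type) (f : 'I_n -> T) : 'I_#|V| -> T :=
  fun i => f (enum_val i).

Section Cumulants.
Variables (R : realType) (P : starProbSpace R).

(* The moment-cumulant relation solved for the one-block term. The first
   argument only bounds the recursion depth; see [moment_cumulant]. *)
Fixpoint cumulant_rec (d n : nat) (chi : 'I_n -> side) (a : 'I_n -> P) : R[i] :=
  if d is d'.+1 then
    phi P (\prod_(i < n) a i)
      - \sum_(pi in BI chi | pi != [set [set: 'I_n]]%SET)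
          \prod_(V in pi) cumulant_rec d' (restr (V:=V) chi) (restr (V:=V) a)
  else 0.

Definition cumulant n (chi : 'I_n -> side) (a : 'I_n -> P) : R[i] :=
  cumulant_rec n chi a.

Definition moment_cumulant_relation
    (B : forall n, ('I_n -> side) -> ('I_n -> P) -> R[i]) : Prop :=
  forall n (chi : 'I_n -> side) (a : 'I_n -> P), (0 < n)%N ->
    phi P (\prod_(i < n) a i)
    = \sum_(pi in BI chi)
        \prod_(V in pi) B #|V| (restr (V:=V) chi) (restr (V:=V) a).

Lemma card_block_lt n (pi : {set {set 'I_n}}) (V : {set 'I_n}) :
  partition pi [set: 'I_n] -> pi != [set [set: 'I_n]]%SET -> V \in pi ->
  (0 < #|V| < n)%N.
Proof.
move=> /and3P[/eqP cpi tpi n0] npi Vpi.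
have V0 : V != finset.set0 by apply: contraNneq n0 => <-.
rewrite card_gt0 V0 ltnNge; apply: contra npi => nV.
have VT : V = [set: 'I_n].
  by apply/eqP; rewrite eqEcard finset.subsetT /= cardsT card_ord.
apply/eqP/setP => W; rewrite inE; apply/idP/eqP => [Wpi|->]; last by rewrite -VT.
rewrite -VT; apply/eqP; apply: contraT => WV.
have := fintype.disjointFr (trivIsetP tpi _ _ Wpi Vpi WV).
have : W != finset.set0 by apply: contraNneq n0 => <-.
by case/finset.set0Pn => x xW /(_ x xW); rewrite VT finset.in_setT.
Qed.

Lemma BI_partition n (chi : 'I_n -> side) pi :
  pi \in BI chi -> partition pi [set: 'I_n].
Proof. by rewrite inE => /andP[]. Qed.

Lemma BI_one n (chi : 'I_n -> side) :
  (0 < n)%N -> [set [set: 'I_n]]%SET \in BI chi.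
Proof.
move=> n0; rewrite inE; apply/andP; split.
  rewrite /partition finset.cover1 eqxx trivIset1 /= inE eq_sym.
  by rewrite -card_gt0 cardsT card_ord.
apply/forallP => V; apply/implyP; rewrite inE => /eqP ->.
by do 3!(apply/forallP => ?; apply/implyP => _); rewrite inE.
Qed.

Lemma restr_setT (T : Type) (B : forall n, ('I_n -> side) -> ('I_n -> T) -> R[i])
    n (chi : 'I_n -> side) (a : 'I_n -> T) :
  B _ (restr (V:=[set: 'I_n]) chi) (restr (V:=[set: 'I_n]) a) = B n chi a.
Proof.
have gen m (f : 'I_m -> 'I_n) : m = n -> (forall i, f i = i :> nat) ->
    B m (chi \o f) (a \o f) = B n chi a.
  move=> e; subst m => fE.
  by have -> : f = id by apply/funext => i; exact: val_inj (fE i).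
apply: (gen _ (fun i => enum_val i)); first by rewrite cardsT card_ord.
move=> i; have i_n : (i < n)%N.
  by apply: (leq_trans (ltn_ord i)); rewrite cardsT card_ord.
rewrite (enum_val_nth (Ordinal i_n)).
rewrite (_ : enum _ = enum 'I_n); first by rewrite nth_enum_ord.
by rewrite finset.enum_setT enumT.
Qed.

Lemma eq_proper_blocks B B' n (chi : 'I_n -> side) (a : 'I_n -> P) :
  (forall m (chi' : 'I_m -> side) (a' : 'I_m -> P),
     (0 < m < n)%N -> B m chi' a' = B' m chi' a') ->
  \sum_(pi in BI chi | pi != [set [set: 'I_n]]%SET)
    \prod_(V in pi) B #|V| (restr (V:=V) chi) (restr (V:=V) a)
  = \sum_(pi in BI chi | pi != [set [set: 'I_n]]%SET)
    \prod_(V in pi) B' #|V| (restr (V:=V) chi) (restr (V:=V) a) :> R[i].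
Proof.
move=> BB'; apply: eq_bigr => pi /andP[/BI_partition pP npi].
by apply: eq_bigr => V Vpi; apply: BB'; exact: (card_block_lt pP npi Vpi).
Qed.

Lemma cumulant_rec_depth d n (chi : 'I_n -> side) (a : 'I_n -> P) :
  (0 < n <= d)%N -> cumulant_rec d chi a = cumulant chi a.
Proof.
rewrite /cumulant; elim/ltn_ind: n d chi a => -[//|n] IH [//|d] chi a /=.
rewrite ltnS => nd; congr (_ - _).
apply: (@eq_proper_blocks (@cumulant_rec d) (@cumulant_rec n)) => m chi' a' m_n.
by rewrite (IH m _ d) ?(IH m _ n) //; lia.
Qed.

Lemma moment_cumulant : moment_cumulant_relation cumulant.
Proof.
move=> [//|n] chi a _; rewrite (bigD1 _ (BI_one chi isT)) /= big_set1.
rewrite (restr_setT cumulant).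
rewrite -(@eq_proper_blocks (@cumulant_rec n) cumulant) ?subrK //.
by move=> m chi' a' m_n; rewrite cumulant_rec_depth.
Qed.

Lemma cumulant_unique B : moment_cumulant_relation B ->
  forall n (chi : 'I_n -> side) (a : 'I_n -> P), (0 < n)%N ->
    B n chi a = cumulant chi a.
Proof.
move=> HB; elim/ltn_ind => -[//|n] IH chi a _.
have := HB _ chi a isT; rewrite (moment_cumulant chi a isT).
rewrite !(bigD1 _ (BI_one chi isT)) /= !big_set1.
rewrite (restr_setT cumulant) (restr_setT B).
rewrite (@eq_proper_blocks B cumulant); first by move/addIr.
by move=> m chi' a' /andP[m0 m_n]; exact: IH.
Qed.

(* A formal letter is a pair (side, exponent): (lft, _) stands for x or x^*,
   (rgt, _) for y or y^*. Letters remain distinct even if, say, x = x^*. *)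
Definition letter_val (x y : P) (u : side * exponent) : P :=
  let z := if u.1 == lft then x else y in
  if u.2 == expo_star then star z else z.

(* omega is 0-based and only its first 2m values matter. *)
Definition alternating n (chi : 'I_n -> side) (eps : 'I_n -> exponent) : Prop :=
  exists (m k : nat) (omega : nat -> exponent),
    [/\ n = (2 * m)%N, (k <= 2 * m)%N,
        (forall i, (i.+1 < 2 * m)%N -> omega i <> omega i.+1)
      & [seq (chi i, eps i) | i <- s_chi chi]
        = [seq (lft, omega i) | i <- iota 0 k]
            ++ [seq (rgt, omega i) | i <- iota k (2 * m - k)]].

Definition eta_diagonal (x y : P) : Prop :=
  forall n (chi : 'I_n -> side) (eps : 'I_n -> exponent),
    ~ alternating chi eps ->
    cumulant chi (fun i => letter_val x y (chi i, eps i)) = 0.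

End Cumulants.

Definition omega_constant n (K : Type) (omega : 'I_n -> K)
    (pi : {set {set 'I_n}}) : Prop :=
  forall V, V \in pi -> {in V &, forall i j, omega i = omega j}.

Definition refines n (pi1 pi2 : {set {set 'I_n}}) : Prop :=
  forall V, V \in pi1 -> exists2 W, W \in pi2 & V \subset W.

Definition is_largest n (K : Type) (omega : 'I_n -> K) (chi : 'I_n -> side)
    (pi : {set {set 'I_n}}) : Prop :=
  [/\ pi \in BI chi, omega_constant omega pi
    & forall pi', pi' \in BI chi -> omega_constant omega pi' -> refines pi' pi].

Lemma mem_s_chi n (chi : 'I_n -> side) i : i \in s_chi chi.
Proof.
have ie : i \in enum 'I_n by rewrite mem_enum.
by rewrite mem_cat mem_rev !(mem_filter _ i (enum 'I_n)) ie !andbT; case: (chi i).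
Qed.

Lemma index_s_chi_inj n (chi : 'I_n -> side) :
  injective (fun i => index i (s_chi chi)).
Proof.
move=> i j /= e; rewrite -(nth_index i (mem_s_chi chi i)) e.
by rewrite nth_index // mem_s_chi.
Qed.

Lemma is_largest_exists n (K : Type) (omega : 'I_n -> K) (chi : 'I_n -> side) :
  exists pi, is_largest omega chi pi.
Proof.
pose p i := index i (s_chi chi).
pose r i j := [forall k, ((p i <= p k <= p j) || (p j <= p k <= p i))%N
                           ==> `[< omega k = omega i >]].
have rP i j : reflect (forall k,
    ((p i <= p k <= p j) || (p j <= p k <= p i))%N -> omega k = omega i) (r i j).
  apply: (iffP forallP) => H k; first by move=> h; move: (H k); rewrite h => /asboolP.
  by apply/implyP => /(H k) ?; apply/asboolP.
have rr i : r i i.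
  apply/rP => k h; congr omega; apply: (@index_s_chi_inj _ chi).
  by change (p k = p i); lia.
have romega i j : r i j -> omega j = omega i by move/rP; apply; lia.
have rsym i j : r i j -> r j i.
  by move=> rij; apply/rP => k h; rewrite (romega _ _ rij); apply: (rP _ _ rij); lia.
have rtr i j k : r i j -> r j k -> r i k.
  move=> rij rjk; apply/rP => l h.
  have [h1|h1] : ((p i <= p l <= p j) || (p j <= p l <= p i))%N \/
    ((p j <= p l <= p k) || (p k <= p l <= p j))%N by lia.
  - exact: (rP _ _ rij).
  - by rewrite (rP _ _ rjk) // (romega _ _ rij).
have req : {in [set: 'I_n] & &, equivalence_rel r}.
  move=> i j k _ _ _; split=> // rij; apply/idP/idP; last exact: rtr.
  by apply: rtr; apply: rsym.
exists (equivalence_partition r [set: 'I_n]).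
have blockP V : V \in equivalence_partition r [set: 'I_n] ->
    exists x, forall y, (y \in V) = r x y.
  by case/finset.imsetP => x _ ->; exists x => y; rewrite !inE.
split.
- rewrite inE; apply/andP; split; first exact: equivalence_partitionP.
  apply/forallP => V; apply/implyP => /blockP[x Vx].
  apply/forallP => i; apply/implyP; rewrite Vx => xi.
  apply/forallP => k; apply/implyP; rewrite Vx => xk.
  apply/forallP => j; apply/implyP; rewrite Vx /chi_lt -/(p i) -/(p j) -/(p k) => ijk.
  have rik := rtr _ _ _ (rsym _ _ xi) xk; apply: rtr xi _.
  by apply/rP => l h; apply: (rP _ _ rik); lia.
- by move=> V /blockP[x Vx] i j; rewrite !Vx => /romega -> /romega ->.
move=> pi' pi'BI pi'c V Vpi'.
have /and3P[_ _ n0] := BI_partition pi'BI.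
have /finset.set0Pn[x xV] : V != finset.set0 by apply: contraNneq n0 => <-.
exists ([set y in [set: 'I_n] | r x y])%SET; first by apply: finset.imset_f; rewrite inE.
apply/fintype.subsetP => y yV; rewrite !inE /=; apply/rP => k h.
apply: (pi'c _ Vpi') => //.
move: pi'BI; rewrite inE => /andP[_ /forallP/(_ V)]; rewrite Vpi' /= => Vint.
have int i j : i \in V -> j \in V -> (p i < p k < p j)%N -> k \in V.
  move=> iV jV ikj; move: Vint => /forallP/(_ i); rewrite iV => /forallP/(_ j).
  by rewrite jV => /forallP/(_ k)/implyP; apply.
have pe i : p k = p i -> k = i by apply: index_s_chi_inj.
have [/pe ->//|kx] := eqVneq (p k) (p x).
have [/pe ->//|ky] := eqVneq (p k) (p y).
have [h1|h1] : (p x < p k < p y)%N \/ (p y < p k < p x)%N by lia.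
- exact: int h1.
- exact: int h1.
Qed.

Section Independence.
Variables (R : realType) (P : starProbSpace R).

Definition nonunital_subalgebra (S : set P) : Prop :=
  [/\ S 0, (forall a b, S a -> S b -> S (a + b)),
      (forall (c : R[i]) a, S a -> S (c *: a))
    & (forall a b, S a -> S b -> S (a * b))].

Record nuSubalg := NuSubalg {
  carrier :> set P;
  carrierP : nonunital_subalgebra carrier
}.

Lemma smallest_nonunital (E : set P) :
  nonunital_subalgebra (smallest nonunital_subalgebra E).
Proof.
split.
- by move=> S [[]].
- by move=> a b Sa Sb S HS; have [[_ SD _ _] _] := HS; apply: SD; [apply: Sa|apply: Sb].
- by move=> c a Sa S HS; have [[_ _ SZ _] _] := HS; apply: SZ; apply: Sa.
- by move=> a b Sa Sb S HS; have [[_ _ _ SM] _] := HS; apply: SM; [apply: Sa|apply: Sb].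
Qed.

Definition generated (a : P) : nuSubalg :=
  NuSubalg (smallest_nonunital [set a]%classic).

(* [S k lft] and [S k rgt] are the left and right algebras of the k-th pair. *)
Definition biBoolean_independent (K : Type) (S : K -> side -> nuSubalg) : Prop :=
  forall n (chi : 'I_n -> side) (omega : 'I_n -> K) (a : 'I_n -> P),
    (forall j, carrier (S (omega j) (chi j)) (a j)) ->
    forall pi, is_largest omega chi pi ->
      phi P (\prod_(i < n) a i)
      = \prod_(V in pi) phi P (\prod_(j < n | j \in V) a j).

Definition biBoolean_independent_pairs (p1 p2 : P * P) : Prop :=
  biBoolean_independent (fun (k : bool) (s : side) =>
    let p := if k then p1 else p2 in
    generated (if s == lft then p.1 else p.2)).

End Independence.

(* Main.v *)
(* If the moments of a pair (x, y) vanish on every nonempty word using only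
   left letters or only right letters, then its bi-Boolean cumulants equal its
   moments, because a nontrivial interval partition always has a one-sided
   block. So eta-diagonality only requires the moments to vanish off the
   alternating words.

   Take matrix units of M_4(C) with x = E_02 and y = E_30 + E_31. Compressed to
   the span of e_0, e_1, a word in x, x^*, y, y^* vanishes unless it is a word
   in the rank-one matrices p = xx^* and q = y^*y, and every such word is
   alternating. The hermitian functional phi(A) = A_11 - (A_01 + A_10)/2 kills p
   and q, hence all nonempty one-sided words, but phi(pq) = -1/2, whereas
   bi-Boolean independence would give phi(pq) = phi(p) phi(q) = 0. *)
Require Import Defs.
From HB Require Import structures.
From mathcomp Require Import boolp classical_sets reals.
From mathcomp Require Import all_boot all_order all_algebra.
From mathcomp Require Import complex.
From mathcomp Require Import zify ring.

Set Implicit Arguments.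
Unset Strict Implicit.
Unset Printing Implicit Defensive.

Import GRing.Theory Num.Theory.
Local Open Scope ring_scope.

(** * Interval blocks for the bi-Boolean order *)

Section BlocksAndSides.
Variables (n : nat) (chi : 'I_n -> side).

Lemma chi_lt_lft_rgt i j : chi i = lft -> chi j = rgt -> chi_lt chi i j.
Proof.
move=> il jr; rewrite /chi_lt /s_chi !index_cat.
rewrite !(mem_filter _ _ (enum 'I_n)) il jr !mem_enum /=.
apply: (@leq_trans (size [seq i <- enum 'I_n | chi i == lft])); last exact: leq_addr.
by rewrite index_mem (mem_filter _ _ (enum 'I_n)) il mem_enum.
Qed.

(** Every left index precedes every right index, so [k] lies between [i] and [j] in the order of
    [chi]. *)
Lemma mixed_interval_lft_closed (V : {set 'I_n}) i j k :
  is_interval chi V -> i \in V -> chi i = lft -> j \in V -> chi j = rgt ->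
  chi_lt chi i k -> chi k = lft -> k \in V.
Proof.
move=> /forallP/(_ i) + iV il jV jr ik kl; rewrite iV => /forallP/(_ j).
by rewrite jV => /forallP/(_ k)/implyP; apply; rewrite ik chi_lt_lft_rgt.
Qed.

(* Two mixed intervals would both contain the place where the letters switch
   from left to right. *)
Lemma one_sided_block (pi : {set {set 'I_n}}) :
  pi \in BI chi -> pi != [set [set: 'I_n]]%SET -> (0 < n)%N ->
  exists2 V, V \in pi & exists s, forall i, i \in V -> chi i = s.
Proof.
move=> piBI npi n0; have pP := BI_partition piBI.
have /and3P[/eqP cpi tpi e0] := pP.
have int V : V \in pi -> is_interval chi V.
  by move=> Vpi; move: piBI; rewrite inE => /andP[_ /forallP/(_ V)]; rewrite Vpi.
apply: contrapT => none.
have mixed V : V \in pi ->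
    exists i j, [/\ i \in V, chi i = lft, j \in V & chi j = rgt].
  move=> Vpi; apply: contrapT => nV; apply: none; exists V => //.
  have [/existsP[i /andP[iV /eqP il]]|/existsPn nl] :=
    boolP [exists i, (i \in V) && (chi i == lft)].
    exists lft => j jV; case jl: (chi j) => //; case: nV.
    by exists i, j; split.
  by exists rgt => j jV; have := nl j; rewrite jV /=; case: (chi j).
have : Ordinal n0 \in cover pi by rewrite cpi inE.
case/bigcupP => V Vpi _.
have /andP[_ Vn] := card_block_lt pP npi Vpi.
have [z zV] : exists z, z \notin V.
  apply/existsP; apply: contraLR Vn; rewrite negb_exists => /forallP VT.
  rewrite -leqNgt -[n in (n <= _)%N]card_ord -cardsT; apply: subset_leq_card.
  by apply/fintype.subsetP => z _; have := VT z; rewrite negbK.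
have : z \in cover pi by rewrite cpi inE.
case/bigcupP => W Wpi zW.
have VW : V != W by apply: contraNneq zV => ->.
have dis := trivIsetP tpi _ _ Vpi Wpi VW.
have [i [j [iV il jV jr]]] := mixed V Vpi.
have [i' [j' [iW il' jW jr']]] := mixed W Wpi.
have nii : i != i' by apply: contraTneq iV => ->; rewrite (fintype.disjointFl dis iW).
have : chi_lt chi i i' || chi_lt chi i' i.
  rewrite /chi_lt -neq_ltn; apply: contra nii => /eqP e.
  by apply/eqP; exact: (@index_s_chi_inj _ chi).
case/orP => lt.
  have := mixed_interval_lft_closed (int V Vpi) iV il jV jr lt il'.
  by rewrite (fintype.disjointFl dis iW).
have := mixed_interval_lft_closed (int W Wpi) iW il' jW jr' lt il.
by rewrite (fintype.disjointFr dis iV).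
Qed.

End BlocksAndSides.

(** * Reduction of cumulants to moments *)

Section OneSidedVanishing.
Variables (R : realType) (P : starProbSpace R).

(** Strong induction on [n]: every partition with more than one block has a one-sided block. Its
    cumulant is, by induction, a one-sided moment, hence 0, so only the one-block term survives. *)
Lemma cumulant_eq_moment (x y : P) :
  (forall n (chi : 'I_n -> side) (eps : 'I_n -> exponent) s, (0 < n)%N ->
     (forall i, chi i = s) ->
     phi P (\prod_(i < n) letter_val x y (chi i, eps i)) = 0) ->
  forall n (chi : 'I_n -> side) (eps : 'I_n -> exponent), (0 < n)%N ->
    cumulant chi (fun i => letter_val x y (chi i, eps i))
    = phi P (\prod_(i < n) letter_val x y (chi i, eps i)).
Proof.
move=> one_sided; elim/ltn_ind => n IH chi eps n0.
rewrite (moment_cumulant chi _ n0) (bigD1 _ (BI_one chi n0)) /= big_set1.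
rewrite (restr_setT (@cumulant R P)) big1 ?addr0 // => pi /andP[piBI npi].
have [V Vpi [s Vs]] := one_sided_block piBI npi n0.
have /andP[V0 Vn] := card_block_lt (BI_partition piBI) npi Vpi.
rewrite (bigD1 V Vpi) /=.
rewrite (IH _ Vn (restr (V:=V) chi) (restr (V:=V) eps) V0).
rewrite (one_sided _ _ _ s) ?mul0r // => i.
exact: Vs (enum_valP i).
Qed.

End OneSidedVanishing.

(** * Words in x x^* and y^* y, and their alternation *)

Section Words.

Notation letter := (side * exponent)%type.

Definition is_xxs (u v : letter) := (u == (lft, expo1)) && (v == (lft, expo_star)).
Definition is_ysy (u v : letter) := (u == (rgt, expo_star)) && (v == (rgt, expo1)).

Fixpoint xxs_ysy_word (w : seq letter) : bool :=
  match w with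
  | [::] => true
  | u :: v :: w' => (is_xxs u v || is_ysy u v) && xxs_ysy_word w'
  | _ => false
  end.

Lemma xxs_ysy_word_ind (Q : seq letter -> Prop) :
  Q [::] ->
  (forall w, xxs_ysy_word w -> Q w -> Q [:: (lft, expo1), (lft, expo_star) & w]) ->
  (forall w, xxs_ysy_word w -> Q w -> Q [:: (rgt, expo_star), (rgt, expo1) & w]) ->
  forall w, xxs_ysy_word w -> Q w.
Proof.
move=> Q0 Ql Qr w; have [N] := ubnP (size w).
elim: N w => // N IH [|u [|v w]] //= szw /andP[uv ww].
have Qw : Q w by apply: IH => //; rewrite ltnS in szw; exact: leq_trans szw.
by case/orP: uv => /andP[/eqP-> /eqP->]; [apply: Ql|apply: Qr].
Qed.

(** The left letters have exponents 1, *, 1, * forwards; the right ones have *, 1, *, 1 forwards,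
    hence 1, *, 1, * backwards. The even start [j] is left free so that the right run can be
    numbered after the left one. *)
Lemma xxs_ysy_word_sides w : xxs_ysy_word w ->
  exists a b, forall j, ~~ odd j ->
    [seq u <- w | u.1 == lft] = [seq (lft, odd i) | i <- iota j (2 * a)] /\
    rev [seq u <- w | u.1 == rgt] = [seq (rgt, odd i) | i <- iota j (2 * b)].
Proof.
elim/xxs_ysy_word_ind => [|{}w _ [a [b ab]]|{}w _ [a [b ab]]].
- by exists 0%N, 0%N.
- exists a.+1, b => j je; have [_ Hr] := ab j je.
  have [|Hl _] := ab j.+2; first by rewrite /= negbK.
  split; last by rewrite -Hr.
  by rewrite (_ : 2 * a.+1 = (2 * a).+2)%N; [rewrite /= Hl (negbTE je)|lia].
- exists a, b.+1 => j je; have [Hl Hr] := ab j je; split; first by rewrite -Hl.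
  rewrite (_ : 2 * b.+1 = 2 * b + 2)%N; last by lia.
  (* A pair put in front of the word lands at the end of the reversed list, at indices [j + 2 * b]
     and its successor. *)
  rewrite iotaD map_cat -Hr /= !rev_cons -!cats1 -catA /=.
  by rewrite oddD oddM /= (negbTE je).
Qed.

Lemma xxs_ysy_word_alternating n (chi : 'I_n -> side) (eps : 'I_n -> exponent) :
  xxs_ysy_word [seq (chi i, eps i) | i <- enum 'I_n] -> alternating chi eps.
Proof.
set w := map _ _ => /[dup] ww /xxs_ysy_word_sides[a [b ab]].
have [Hl _] := ab 0%N isT.
(* The right run starts where the left one stops, at the even index [2 * a], so [odd] alternates
   across the switch. *)
have [|_ Hr] := ab (2 * a)%N; first by rewrite oddM.
have sE : [seq (chi i, eps i) | i <- s_chi chi]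
    = [seq u <- w | u.1 == lft] ++ rev [seq u <- w | u.1 == rgt].
  by rewrite /s_chi /w map_cat map_rev !filter_map.
exists (a + b)%N, (2 * a)%N, odd; split.
- have sw : size w = n by rewrite size_map size_enum_ord.
  move/(congr1 size): Hl; move/(congr1 size): Hr.
  rewrite size_rev !(size_filter _ w) [size (map _ (iota _ _))]size_map.
  rewrite [size (map _ (iota 0 _))]size_map !size_iota.
  have := count_predC (fun u : side * exponent => u.1 == lft) w.
  rewrite (@eq_count _ (predC _) (fun u => u.1 == rgt)); last by move=> [[] ?].
  by rewrite -sw => <- -> ->; lia.
- lia.
- by move=> i _ /=; case: (odd i).
- by rewrite sE Hl Hr; congr (_ ++ map _ (iota _ _)); lia.
Qed.

End Words.

(** * The matrix example *)

Section Example.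
Variable R : realType.
Notation C := R[i].
Notation M := 'M[C]_4.

Definition adjoint (A : M) : M := map_mx Num.conj A^T.

(* Chosen to vanish on [xxs] and [ysy] below; it is not positive. *)
Definition functional (A : M) : C := A 1 1 - 2^-1 * (A 0 1 + A 1 0).

Lemma functional_is_linear : linear_for *%R functional.
Proof. by move=> c A B; rewrite /functional !mxE; ring. Qed.
HB.instance Definition _ :=
  GRing.isLinear.Build C M C *%R functional functional_is_linear.

Lemma adjointK : involutive adjoint.
Proof. by move=> A; apply/matrixP => i j; rewrite !mxE conjCK. Qed.

Lemma adjointD A B : adjoint (A + B) = adjoint A + adjoint B.
Proof. by apply/matrixP => i j; rewrite !mxE rmorphD. Qed.

Lemma adjointZ (c : C) A : adjoint (c *: A) = Num.conj c *: adjoint A.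
Proof. by apply/matrixP => i j; rewrite !mxE rmorphM. Qed.

Lemma adjointM A B : adjoint (A * B) = adjoint B * adjoint A.
Proof. by rewrite /adjoint -!mulmxE trmx_mul map_mxM. Qed.

Lemma functional1 : functional 1 = 1.
Proof. by rewrite /functional !mxE /= addr0 mulr0 subr0. Qed.

Lemma functional_adjoint A : functional (adjoint A) = Num.conj (functional A).
Proof.
rewrite /functional !mxE rmorphB rmorphM rmorphD /= fmorphV rmorph_nat.
by rewrite [X in _ * X]addrC.
Qed.

Definition example_space : starProbSpace R :=
  @StarProbSpace R M adjoint functional adjointK adjointD adjointZ adjointM
    functional1 functional_adjoint.

Local Notation E i j := (delta_mx i%R j%R : M).

Definition ex_x : example_space := E 0 2.
Definition ex_y : example_space := E 3 0 + E 3 1.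

Lemma adjoint_delta i j : adjoint (E i j) = E j i.
Proof. by apply/matrixP => k l; rewrite !mxE rmorph_nat andbC. Qed.

Lemma star_x : star ex_x = E 2 0 :> M. Proof. exact: adjoint_delta. Qed.
Lemma star_y : star ex_y = E 0 3 + E 1 3 :> M.
Proof. by rewrite [LHS]adjointD !adjoint_delta. Qed.

(* The moments only see the compression to the span of the first two basis
   vectors. *)
Definition corner : M := E 0 0 + E 1 1.

Definition xxs : M := E 0 0.
(** Twice the projection onto the line of e_0 + e_1. *)
Definition ysy : M := E 0 0 + E 0 1 + E 1 0 + E 1 1.

Notation letter := (side * exponent)%type.

Definition letter_mx (u : letter) : M := letter_val ex_x ex_y u.

Lemma letter_mxE u : letter_mx u =
  match u with
  | (true, false) => E 0 2
  | (true, true) => E 2 0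
  | (false, false) => E 3 0 + E 3 1
  | (false, true) => E 0 3 + E 1 3
  end.
Proof. by case: u => -[] []; rewrite /letter_mx /letter_val ?star_x ?star_y. Qed.

Let simp := (mulmxDl, mulmxDr, mul_delta_mx_cond, mulr0n, mulr1n, mul0mx, addr0, add0r).

(** Letters are off-diagonal for the splitting of C^4 into the spans of e_0, e_1 and of e_2, e_3. *)
Lemma corner_letter u : corner * letter_mx u * corner = 0.
Proof. by rewrite letter_mxE -!mulmxE; case: u => -[] []; rewrite /corner !simp. Qed.

(** Only x and y^* have entries in rows 0 and 1, in columns 2 and 3 respectively; only x^* has an
    entry in row 2, and only y in row 3. *)
Lemma corner_letter2 u v : ~~ (is_xxs u v || is_ysy u v) ->
  corner * letter_mx u * letter_mx v = 0.
Proof.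
by rewrite !letter_mxE -!mulmxE; case: u v => -[] [] [[] []] //= _; rewrite /corner !simp.
Qed.

Lemma letter_xxs : letter_mx (lft, expo1) * letter_mx (lft, expo_star) = xxs.
Proof. by rewrite !letter_mxE -!mulmxE /xxs !simp. Qed.

Lemma letter_ysy : letter_mx (rgt, expo_star) * letter_mx (rgt, expo1) = ysy.
Proof. by rewrite !letter_mxE -!mulmxE /ysy !simp !addrA. Qed.

Lemma xxs_corner : xxs * corner = xxs.
Proof. by rewrite -!mulmxE /corner /xxs !simp. Qed.

Lemma ysy_corner : ysy * corner = ysy.
Proof.
by rewrite -!mulmxE /corner /ysy !simp; apply/matrixP => i j; rewrite !mxE; ring.
Qed.

Lemma xxsM : xxs * xxs = xxs.
Proof. by rewrite -!mulmxE /xxs !simp. Qed.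

Lemma ysyM : ysy * ysy = 2 *: ysy.
Proof.
rewrite -!mulmxE /ysy !simp; apply/matrixP => i j; rewrite !mxE; ring.
Qed.

(** * Moments of words *)

Definition word_mx (w : seq letter) : M := \prod_(u <- w) letter_mx u.

Lemma corner_word w : ~~ xxs_ysy_word w -> corner * word_mx w * corner = 0.
Proof.
have [N] := ubnP (size w); elim: N w => // N IH [|u [|v w]] //= szw.
  by rewrite /word_mx big_seq1 corner_letter.
rewrite negb_and /word_mx !big_cons -/(word_mx w) !mulrA.
have [uv /= nw|nuv _] := boolP (is_xxs u v || is_ysy u v); last first.
  by rewrite corner_letter2 // !mul0r.
have {nw szw}IHw : corner * word_mx w * corner = 0.
  by apply: IH => //; rewrite ltnS in szw; exact: leq_trans szw.
rewrite -[corner * _ * _]mulrA.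
(* The identity [p * corner = p] puts a new corner in front of the remaining word, to which the
   induction hypothesis applies. *)
have [p -> pc] : exists2 p, letter_mx u * letter_mx v = p & p * corner = p.
  case/orP: uv => /andP[/eqP-> /eqP->].
    by exists xxs; [exact: letter_xxs|exact: xxs_corner].
  by exists ysy; [exact: letter_ysy|exact: ysy_corner].
by rewrite -mulrA in IHw; rewrite -pc -!mulrA IHw !mulr0.
Qed.

Lemma functional_corner A : functional (corner * A * corner) = functional A.
Proof.
have row0 k : corner 0 k = (k == 0)%:R by rewrite !mxE /= addr0.
have row1 k : corner 1 k = (k == 1)%:R by rewrite !mxE /= add0r.
have col0 k : corner k 0 = (k == 0)%:R by rewrite !mxE /= andbT andbF addr0.
have col1 k : corner k 1 = (k == 1)%:R by rewrite !mxE /= andbT andbF add0r.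
have mulr i (F : 'I_4 -> C) : \sum_k F k * (k == i)%:R = F i.
  by rewrite (bigD1 i) //= eqxx mulr1 big1 ?addr0 // => k /negbTE->; rewrite mulr0.
have mull i (F : 'I_4 -> C) : \sum_k (k == i)%:R * F k = F i.
  by rewrite -[RHS](mulr i); apply: eq_bigr => k _; rewrite mulrC.
have entry i j : (i == 0) || (i == 1) -> (j == 0) || (j == 1) ->
    (corner * A * corner) i j = A i j.
  move=> i01 j01; rewrite -!mulmxE mxE.
  under eq_bigr => k _.
    rewrite (_ : corner k j = (k == j)%:R); last by case/orP: j01 => /eqP->.
    over.
  rewrite mulr mxE.
  under eq_bigr => k _.
    rewrite (_ : corner i k = (k == i)%:R); last by case/orP: i01 => /eqP->.
    over.
  exact: mull.
by rewrite /functional !entry.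
Qed.

(** Such a word is a positive power of [xxs] or of [ysy], and both matrices are idempotent up to a
    scalar. *)
Lemma one_sided_xxs_ysy_word w s : w != [::] -> xxs_ysy_word w ->
  all (fun u => u.1 == s) w ->
  exists c : C, word_mx w = c *: (if s == lft then xxs else ysy).
Proof.
move=> w0 ww; elim/xxs_ysy_word_ind: ww w0 => // {}w ww IH _ /=.
all: move=> /and3P[/eqP es _ ws]; subst s.
- have [->|w0] := eqVneq w [::].
    by exists 1; rewrite /word_mx !big_cons big_nil mulr1 letter_xxs scale1r.
  have [c wE] := IH w0 ws; exists c.
  by rewrite /word_mx !big_cons -/(word_mx w) wE mulrA letter_xxs -scalerAr xxsM.
- have [->|w0] := eqVneq w [::].
    by exists 1; rewrite /word_mx !big_cons big_nil mulr1 letter_ysy scale1r.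
  have [c wE] := IH w0 ws; exists (c * 2).
  by rewrite /word_mx !big_cons -/(word_mx w) wE mulrA letter_ysy -scalerAr ysyM scalerA.
Qed.

Lemma functional_xxs : functional xxs = 0.
Proof. by rewrite /functional !mxE /= !addr0 mulr0 subr0. Qed.

Lemma functional_ysy : functional ysy = 0.
Proof. by rewrite /functional !mxE /= !(addr0, add0r) mulVf ?subrr // pnatr_eq0. Qed.

Lemma functional_xxs_ysy : functional (xxs * ysy) = - 2^-1.
Proof. by rewrite -mulmxE !simp /functional !mxE /= !(addr0, add0r) mulr1. Qed.

Lemma functional_word w : ~~ xxs_ysy_word w -> functional (word_mx w) = 0.
Proof. by move=> nw; rewrite -functional_corner corner_word // linear0. Qed.

Lemma functional_one_sided_word w s :
  w != [::] -> all (fun u => u.1 == s) w -> functional (word_mx w) = 0.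
Proof.
move=> w0 ws; have [ww|] := boolP (xxs_ysy_word w); last exact: functional_word.
have [c ->] := one_sided_xxs_ysy_word w0 ww ws.
by rewrite linearZ /=; case: (s == lft); rewrite ?functional_xxs ?functional_ysy mulr0.
Qed.

Lemma letters_prod n (chi : 'I_n -> side) (eps : 'I_n -> exponent) :
  \prod_(i < n) letter_val ex_x ex_y (chi i, eps i)
  = word_mx [seq (chi i, eps i) | i <- enum 'I_n].
Proof. by rewrite /word_mx big_map enumT [index_enum _]unlock. Qed.

(** * Eta-diagonality and failure of independence *)

Lemma example_eta_diagonal : eta_diagonal ex_x ex_y.
Proof.
(* For [n = 0] the cumulant is 0 by the base case of its recursion. *)
move=> [//|n] chi eps nalt.
rewrite cumulant_eq_moment //.
  rewrite letters_prod; apply: functional_word.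
  by apply/negP => /xxs_ysy_word_alternating.
move=> m chi' eps' s m0 chiE; rewrite letters_prod.
apply: (@functional_one_sided_word _ s).
  by rewrite -size_eq0 size_map size_enum_ord -lt0n.
by rewrite all_map; apply/allP => i _ /=; rewrite chiE.
Qed.

Lemma generated_self (a : example_space) : carrier (generated a) a.
Proof. by move=> S [_]; apply. Qed.

Lemma example_not_independent : ~ biBoolean_independent_pairs
  (ex_x * star ex_x, ex_y * star ex_y) (star ex_x * ex_x, star ex_y * ex_y).
Proof.
have px : ex_x * star ex_x = xxs by rewrite -letter_xxs.
have qy : star ex_y * ex_y = ysy by rewrite -letter_ysy.
have phix : phi example_space xxs = 0 := functional_xxs.
have phixy : phi example_space (xxs * ysy) = - 2^-1 := functional_xxs_ysy.
(* [first] serves both as [chi] and as [omega]: index 0 is a left element of the first pair, index 1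
   a right element of the second. *)
pose first (i : 'I_2) : bool := i == 0.
pose a (i : 'I_2) : example_space := if first i then xxs else ysy.
move=> /(_ 2%N first first a) indep.
have [pi piL] := is_largest_exists first first.
have {indep} := indep _ pi piL; rewrite /= px qy => indep.
have [piBI piC _] := piL.
have /and3P[/eqP cpi _ _] := BI_partition piBI.
have : 0 \in cover pi by rewrite cpi inE.
case/bigcupP => V Vpi V0.
(* As [omega] separates the two indices, the block of 0 is a singleton and contributes the factor
   phi([xxs]) = 0. *)
have VE j : (j \in V) = (j == 0).
  apply/idP/eqP => [jV|->//]; have := piC V Vpi j 0 jV V0.
  by rewrite /first eqxx => /eqP.
have {indep} := indep _; rewrite (bigD1 V Vpi) /=.
rewrite (eq_bigl _ _ VE) big_pred1_eq /a /first eqxx phix mul0r.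
rewrite !big_ord_recl big_ord0 mulr1 /= phixy.
move=> H; have /eqP : - 2^-1 = 0 :> C.
  by apply: H => -[[|[|]]] //= ? /=; rewrite ?px ?qy; exact: generated_self.
by rewrite oppr_eq0 invr_eq0 pnatr_eq0.
Qed.

End Example.

Theorem corollary4p10 (R : realType) :
  exists (P : starProbSpace R) (x y : P),
    eta_diagonal x y /\
    ~ biBoolean_independent_pairs
        (x * star x, y * star y) (star x * x, star y * y).
Proof.
exists (example_space R), (ex_x R), (ex_y R).
by split; [exact: example_eta_diagonal|exact: example_not_independent].
Qed.
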